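(* Let $G_S$ be a self-loop graph of order $N$ with $|S|\ge1$ and let $\widetilde G$ be its Açıkmeşe lift. Let $q>0$ and $c\le0$, and let $e_1\ge e_2\ge\cdots\ge e_{2N+1}\ge0$ be the eigenvalues (with multiplicity) of $\Phi_q(\mathcal{L}(\widetilde G),c)$, where $e_{2N+1}$ is the eigenvalue corresponding to the constant vector $\mathbf 1$, which lies in $(\mathbb{R}^{\widetilde V})^+=\ker(T-I)$. Let $\mathrm{Spec}^*(\Phi_q(M_{sym},c))$ be the multiset obtained from the spectrum (with multiplicity) of $\Phi_q(M_{sym},c)$ by deleting precisely one copy of the eigenvalue $e_{2N+1}$. Then $$\mathcal{M}_q(M_{sym},c)-\mathcal{M}_q(\mathcal{L}(G_S),c)\le e_{2N+1}+\sum_{i=1}^{N}e_i-\sum_{i=N+1}^{2N}e_i,$$ and equality holds if and only if $$\min_{\lambda\in\mathrm{Spec}^*(\Phi_q(M_{sym},c))}\lambda\;\ge\;\max_{\nu\in\mathrm{Spec}(\Phi_q(\mathcal{L}(G_S),c))}\nu.$$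
   Context: Let $G$ be a finite undirected simple graph with vertex set $V=\{1,\dots,N\}$ (possibly disconnected), and $S\subseteq V$. The self-loop graph $G_S$ is obtained from $G$ by attaching one loop at every vertex of $S$; $\sigma=|S|$. The loop vector $s\in\mathbb{R}^N$ is the indicator vector of $S$. $\mathcal{L}(G)=D(G)-A(G)$ is the ordinary Laplacian and $\mathcal{L}(G_S):=\mathcal{L}(G)+\mathrm{diag}(s)$. For $\sigma\ge1$, the Açıkmeşe lift $\widetilde G=(\widetilde V,\widetilde E)$ of $G_S$ is the simple graph on $\widetilde V=\{1,\dots,2N+1\}$ such that: for each edge $\{i,j\}$ of $G$, both $\{i,j\}$ and $\{i+N+1,j+N+1\}$ are edges of $\widetilde G$; for each $i\in S$, both $\{i,N+1\}$ and $\{N+1,i+N+1\}$ are edges; there are no other edges. $\mathcal{L}(\widetilde G)$ is the ordinary Laplacian of $\widetilde G$. The involution matrix $T$ is the $(2N+1)\times(2N+1)$ permutation matrix of the map swapping $i\leftrightarrow i+N+1$ ($1\le i\le N$) and fixing $N+1$. $M_{sym}=\begin{pmatrix}2\sigma&-\sqrt2\,s^\top\\ -\sqrt2\,s&\mathcal{L}(G_S)\end{pmatrix}\in\mathbb{R}^{(N+1)\times(N+1)}$. For a real symmetric matrix $B$ of order $r$ with eigenvalues $\lambda_1(B),\dots,\lambda_r(B)$ (with multiplicity), $\mathcal{M}_q(B,c)=\sum_{i=1}^r|\lambda_i(B)-c|^q$, and $\Phi_q(B,c)=|B-cI_r|^q$ is defined by spectral functional calculus (apply $x\mapsto|x-c|^q$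 to $B$). Since $\mathcal{L}(\widetilde G)\mathbf 1=0$, the eigenvalue of $\Phi_q(\mathcal{L}(\widetilde G),c)$ at $\mathbf 1$ is $|c|^q$. *)

(* Defs.v *)
From HB Require Import structures.
From mathcomp Require Import all_boot all_order all_algebra.
From mathcomp Require Import all_classical all_reals all_analysis.
From mathcomp Require Import polyrcf.
Set Implicit Arguments.
Unset Strict Implicit.
Unset Printing Implicit Defensive.
Import Order.TTheory GRing.Theory Num.Theory.
Local Open Scope ring_scope.

Record sgraph (n : nat) := SGraph {
  adj :> rel 'I_n;
  adj_sym : symmetric adj;
  adj_irrefl : irreflexive adj }.

Section Laplacian.
Variables (R : realType) (n : nat) (G : sgraph n).

Definition adjacency : 'M[R]_n := \matrix_(i, j) (G i j)%:R.

Definition degree (i : 'I_n) : nat := #|[set j | G i j]|.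

Definition laplacian : 'M[R]_n := diag_mx (\row_i (degree i)%:R) - adjacency.

Variable S : {set 'I_n}.

Definition loop_vector : 'cV[R]_n := \col_i (i \in S)%:R.

Definition loop_laplacian : 'M[R]_n := laplacian + diag_mx loop_vector^T.

Definition Msym : 'M[R]_(1 + n) :=
  block_mx (#|S|%:R *+ 2)%:M (- Num.sqrt 2 *: loop_vector^T)
           (- Num.sqrt 2 *: loop_vector) loop_laplacian.

End Laplacian.
Arguments laplacian R {n} G.
Arguments loop_laplacian R {n} G S.
Arguments Msym R {n} G S.

(* Vertices are numbered from 0, so the 2n + 1 vertices of the lift are
   'I_(n + (1 + n)): [lo i] has value i, [mid] has value n and [hi i] has
   value i + n + 1. *)
Section Lift.
Variable n : nat.

Definition lo (i : 'I_n) : 'I_(n + (1 + n)) := lshift (1 + n) i.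
Definition mid : 'I_(n + (1 + n)) := rshift n (lshift n ord0).
Definition hi (i : 'I_n) : 'I_(n + (1 + n)) := rshift n (rshift 1 i).

Definition same_edge (T : eqType) (u v a b : T) : bool :=
  ((u == a) && (v == b)) || ((u == b) && (v == a)).

Variables (G : sgraph n) (S : {set 'I_n}).

Definition lift_adj : rel 'I_(n + (1 + n)) := fun u v =>
  [exists i, exists j, G i j &&
     (same_edge u v (lo i) (lo j) || same_edge u v (hi i) (hi j))]
  || [exists i in S, same_edge u v (lo i) mid || same_edge u v mid (hi i)].

Lemma same_edgeC (T : eqType) (u v a b : T) :
  same_edge u v a b = same_edge v u a b.
Proof. by rewrite /same_edge orbC andbC [X in _ || X]andbC. Qed.

Lemma same_edge_loop (T : eqType) (u a b : T) : same_edge u u a b -> a = b.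
Proof. by case/orP => /andP[/eqP<- /eqP<-]. Qed.

Lemma lift_adj_sym : symmetric lift_adj.
Proof.
move=> u v; rewrite /lift_adj; congr (_ || _).
  apply: eq_existsb => i; apply: eq_existsb => j.
  by rewrite same_edgeC [X in _ || X]same_edgeC.
by apply: eq_existsb => i; rewrite same_edgeC [X in _ || X]same_edgeC.
Qed.

Lemma lift_adj_irrefl : irreflexive lift_adj.
Proof.
move=> u; apply/negbTE/negP => /orP[/existsP[i /existsP[j]]|/existsP[i]].
  case/andP => Gij /orP[] /same_edge_loop.
    by move/lshift_inj => eij; rewrite eij adj_irrefl in Gij.
  by move/rshift_inj/rshift_inj => eij; rewrite eij adj_irrefl in Gij.
case/andP => _ /orP[] /same_edge_loop /eqP.
  by rewrite eq_lrshift.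
by move/eqP/rshift_inj/eqP; rewrite eq_lrshift.
Qed.

Definition acikmese_lift : sgraph (n + (1 + n)) :=
  SGraph lift_adj_sym lift_adj_irrefl.

End Lift.

Definition swap (n : nat) (u : 'I_(n + (1 + n))) : 'I_(n + (1 + n)) :=
  match fintype.split u with
  | inl i => hi i
  | inr w => match fintype.split w with inl _ => mid n | inr i => lo i end
  end.

Definition involution_mx (R : realType) (n : nat) : 'M[R]_(n + (1 + n)) :=
  \matrix_(u, v) (v == swap u)%:R.

Section Spectrum.
Variables (R : realType) (n : nat).
Implicit Types B : 'M[R]_n.

(* The real eigenvalues of B, repeated according to algebraic multiplicity.
   For a real symmetric B these are all n eigenvalues. *)
Definition spectrum B : seq R :=
  flatten [seq nseq (mup x (char_poly B)) x | x <- rootsR (char_poly B)].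

(* [eig B k] is the k-th largest eigenvalue of B, counted from k = 1. *)
Definition eig B (k : nat) : R := nth 0 (sort >=%R (spectrum B)) k.-1.

(* Spectral functional calculus: f(B) is the sum of f(x) P_x over the distinct
   eigenvalues x, where P_x is the projection onto ker (B - x) along
   im (B - x), which for a symmetric B is the orthogonal projection onto the
   eigenspace.  The row-vector convention is harmless for symmetric B. *)
Definition fun_calc (f : R -> R) B : 'M[R]_n :=
  \sum_(x <- rootsR (char_poly B)) f x *: proj_mx (eigenspace B x) (B - x%:M).

Definition moment (q : R) B (c : R) : R :=
  \sum_(x <- spectrum B) `|x - c| `^ q.

Definition Phi (q : R) B (c : R) : 'M[R]_n :=
  fun_calc (fun x => `|x - c| `^ q) B.

End Spectrum.

(* Minimum and maximum of a nonempty sequence. *)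
Definition seq_min (R : realType) (s : seq R) : R :=
  \big[Num.min/head 0 s]_(x <- s) x.
Definition seq_max (R : realType) (s : seq R) : R :=
  \big[Num.max/head 0 s]_(x <- s) x.

(* Main.v *)
Require Import Defs.
From HB Require Import structures.
From mathcomp Require Import all_boot all_order all_algebra.
From mathcomp Require Import all_classical all_reals all_analysis.
From mathcomp Require Import polyrcf complex ring lra.
Set Implicit Arguments.
Unset Strict Implicit.
Unset Printing Implicit Defensive.
Import Order.TTheory GRing.Theory Num.Theory.
Local Open Scope ring_scope.

(** The swap symmetry of the lift splits its Laplacian: on the vectors that are
odd under the swap it acts as the loop Laplacian, and on the even ones, in an
orthonormal basis, as the matrix M_sym.  Hence the spectrum of the lift is the
disjoint union, with multiplicities, of those of M_sym and of the loop
Laplacian ([spectrum_lift]), and the same holds after applying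
f(x) = |x - c|^q, since for a symmetric matrix the functional calculus maps the
spectrum pointwise by f ([spectrum_fun_calc]).  That last fact rests on the
real spectral theorem, [symmetric_diagonalizable].

The Laplacian of the lift is positive semidefinite and c <= 0, so f is
nondecreasing on its spectrum; the smallest value f 0 is attained at the
constant vector, which is even, so it comes from the kernel of M_sym.  Remove
one copy of f 0.  What remains are 2N numbers, cut into the N numbers of Spec*
and the N eigenvalues of Phi of the loop Laplacian, and the difference of the
two moments is f 0 plus the sum over the first part minus the sum over the
second.  Among all ways of cutting 2N numbers into two halves, this difference
is largest when the first half consists of the N largest numbers.

For the equality case let m be the N-th largest number.  The sum of the N
largest exceeds the sum over a competing half a, with complement b, by exactly
the sum over a of (m - x)^+ plus the sum over b of (x - m)^+
([sum_above_threshold_gap]).  This vanishes only if every element of b is at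
most m and every element of a at least m; conversely, if a lies above b then
the minimum of a is itself a threshold, and exchanging the roles of the two
cuts gives the opposite inequality ([top_bottom_gap]). *)

(** * Diagonalization of real symmetric matrices *)

Lemma char_poly_similar (F : fieldType) n (P A B : 'M[F]_n) :
  P \in unitmx -> A *m P = P *m B -> char_poly A = char_poly B.
Proof.
move=> Pu AP; pose Q := map_mx (@polyC F) P.
have Q0 : \det Q != 0 by rewrite det_map_mx polyC_eq0 -unitfE -unitmxE.
apply: (mulIf Q0); rewrite /char_poly -det_mulmx [RHS]mulrC -det_mulmx.
by rewrite mulmxBl mulmxBr -!map_mxM AP scalar_mxC.
Qed.

(** Over the complex numbers a real symmetric matrix is Hermitian, so it is
similar to a diagonal matrix with real entries; two real matrices that are
similar over the complex numbers are similar through a real matrix. *)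
Lemma symmetric_diagonalizable (R : rcfType) n (A : 'M[R]_n) : A^T = A ->
  exists2 P, P \in unitmx & exists d, A *m P = P *m diag_mx d.
Proof.
move=> Asym; pose toC := real_complex R.
pose AC := map_mx toC A.
have AC_real : AC \is a mxOver Num.real.
  by apply/mxOverP => i j; rewrite mxE; apply/complex_realP; eexists.
have AC_herm : AC \is hermitianmx _ false (@Num.conj _).
  apply: realsym_hermsym => //; apply/is_hermitianmxP.
  rewrite expr0 scale1r map_mx_id //.
  by rewrite /AC map_trmx Asym.
have /orthomx_spectralP ACE := hermitian_normalmx AC_herm.
have D_real := hermitian_spectral_diag_real AC_herm.
have Pu := spectral_unit AC.
have [|||Q] := @real_similar _ _ AC (diag_mx (spectral_diag AC)).
- exists (spectralmx AC) => //; apply/similarP => //.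
  by rewrite [X in _ *m X = _]ACE !mulmxA mulmxV // mul1mx.
- by [].
- by apply/mxOverP => i j; rewrite mxE; case: eqP => _ //;
    rewrite ?mulr1n ?mulr0n ?real0 //; exact: (mxOverP D_real).
rewrite inE => /andP[/mxOverP Qreal Qu] /(similarP Qu) QA.
(* It remains to read real matrices over R[i] as matrices over R. *)
have liftR m k (B : 'M[complex R]_(m, k)) : (forall i j, B i j \is Num.real) ->
    B = map_mx toC (map_mx (@complex.Re R) B).
  by move=> Br; apply/matrixP => i j; rewrite !mxE /toC RRe_real.
move: Qu QA; rewrite (liftR _ _ Q Qreal) (liftR _ _ _ (mxOverP D_real)).
move: (map_mx _ Q) (map_mx _ (spectral_diag AC)) => P d.
rewrite map_unitmx -map_diag_mx -!map_mxM => Pu' /(congr1 (map_mx (@complex.Re R))).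
rewrite -!map_mx_comp !map_mx_id // => PA.
exists P^T; first by rewrite unitmx_tr.
by exists d; rewrite -{1}Asym -trmx_mul PA trmx_mul tr_diag_mx.
Qed.

(** * Spectrum and functional calculus *)

Section Spec.
Variables (R : realType) (n : nat).
Implicit Types (A : 'M[R]_n) (s : seq R).

Lemma char_poly_neq0 A : char_poly A != 0.
Proof. exact/monic_neq0/char_poly_monic. Qed.

Lemma mem_rootsR_char A x : (x \in rootsR (char_poly A)) = eigenvalue A x.
Proof.
by rewrite eigenvalue_root_char -(roots_on_rootsR (char_poly_neq0 A)).
Qed.

Lemma count_spectrum A x : count_mem x (spectrum A) = mup x (char_poly A).
Proof.
have [rx|nrx] := boolP (x \in rootsR (char_poly A)); last first.
  rewrite (@mupNroot _ x) -?eigenvalue_root_char -?mem_rootsR_char //.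
  apply/count_memPn; apply: contra nrx => /flattenP[_ /mapP[y ry ->]].
  by rewrite mem_nseq => /andP[_ /eqP->].
rewrite /spectrum count_flatten -map_comp sumnE big_map.
rewrite (bigD1_seq x) ?uniq_roots //= count_nseq /= eqxx mul1n.
rewrite big1 ?addn0 // => y yx; rewrite count_nseq /=.
by rewrite (negbTE yx) mul0n.
Qed.

Lemma mem_spectrum A x : (x \in spectrum A) = eigenvalue A x.
Proof.
rewrite -has_pred1 has_count count_spectrum -XsubC_dvd ?char_poly_neq0 //.
by rewrite dvdp_XsubCl -eigenvalue_root_char.
Qed.

Lemma spectrum_perm A s :
  char_poly A = \prod_(x <- s) ('X - x%:P) -> perm_eq (spectrum A) s.
Proof.
move=> As; apply/allP => x _ /=.
by rewrite count_spectrum As mu_prod_XsubC.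
Qed.

(** A vector in the kernel and in the image of the symmetric matrix A - y is
orthogonal to itself. *)
Lemma eigenspace_cap_image A y : A^T = A ->
  (eigenspace A y :&: (A - y%:M) = 0)%MS.
Proof.
move=> Asym.
apply/eqP; rewrite -submx0; apply/rV_subP => w.
rewrite sub_capmx => /andP[/sub_kermxP w0 /submxP[z wz]].
rewrite submx0; have: w *m w^T = 0.
  rewrite {1}wz -mulmxA -[X in X *m w^T]trmxK -trmx_mul.
  by rewrite linearB /= Asym tr_scalar_mx w0 trmx0 mulmx0.
move=> /matrixP /(_ 0 0); rewrite !mxE => ww0.
apply/eqP/rowP => i; rewrite mxE.
have: \sum_j w 0 j ^+ 2 = 0.
  by rewrite -[RHS]ww0; apply: eq_bigr => j _; rewrite mxE.
move/psumr_eq0P => /(_ (fun j _ => sqr_ge0 _)) /(_ i isT) /eqP.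
by rewrite sqrf_eq0 => /eqP.
Qed.

Lemma eigenspace_add_image A y : A^T = A ->
  (1%:M <= eigenspace A y + (A - y%:M))%MS.
Proof.
move=> Asym; rewrite sub1mx /row_full; apply/eqP.
have := mxrank_sum_cap (eigenspace A y) (A - y%:M).
by rewrite eigenspace_cap_image // mxrank0 addn0 => ->; rewrite mxrank_ker subnK ?rank_leq_row.
Qed.

(** The projections in [fun_calc] act on rows, whereas u is a column.  For
y <> x the rows of the projection onto the y-eigenspace are left eigenvectors
for y, hence orthogonal to u; for y = x the rows of its complement lie in the
image of A - x, which annihilates u. *)
Lemma fun_calc_eigen f A x (u : 'cV[R]_n) : A^T = A ->
  A *m u = x *: u -> fun_calc f A *m u = f x *: u.
Proof.
move=> Asym Au; have [->|u0] := eqVneq u 0; first by rewrite mulmx0 scaler0.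
have in_r : x \in rootsR (char_poly A).
  rewrite mem_rootsR_char; apply/eigenvalueP; exists u^T; last by rewrite trmx_eq0.
  by rewrite -{1}Asym -trmx_mul Au linearZ.
rewrite /fun_calc mulmx_suml (bigD1_seq x) ?uniq_roots //= big1 ?addr0.
  rewrite -scalemxAl; congr (_ *: _); apply/eqP; rewrite eq_sym -subr_eq0.
  have := proj_mx_compl_sub (eigenspace_add_image x Asym); rewrite mul1mx => /submxP[z].
  move/(congr1 (mulmx^~ u)); rewrite mulmxBl mul1mx => ->.
  by rewrite -mulmxA mulmxBl Au mul_scalar_mx subrr mulmx0.
move=> y yx; rewrite -scalemxAl; apply/eqP; rewrite scaler_eq0; apply/orP; right.
have := proj_mx_sub (eigenspace A y) (A - y%:M) (1%:M : 'M[R]_n).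
rewrite mul1mx => /eigenspaceP /(congr1 (mulmx^~ u)).
rewrite -mulmxA Au -scalemxAr -scalemxAl => /eqP.
by rewrite -subr_eq0 -scalerBl scaler_eq0 subr_eq0 eq_sym (negbTE yx).
Qed.

End Spec.

Lemma spectrum_diagonalized (R : realType) n (A P : 'M[R]_n) (d : 'rV_n) :
  P \in unitmx -> A *m P = P *m diag_mx d ->
  perm_eq (spectrum A) [seq d 0 i | i : 'I_n].
Proof.
move=> Pu AP; apply: spectrum_perm; rewrite (char_poly_similar Pu AP).
rewrite char_poly_trig ?diag_mx_is_trig // big_map big_enum /=.
by apply: eq_bigr => i _; rewrite mxE eqxx.
Qed.

(** A basis of eigenvectors of A also diagonalizes f(A), with f applied to each
diagonal entry. *)
Lemma spectrum_fun_calc (R : realType) n (f : R -> R) (A : 'M[R]_n) : A^T = A ->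
  perm_eq (spectrum (fun_calc f A)) [seq f x | x <- spectrum A].
Proof.
move=> Asym; have [P Pu [d AP]] := symmetric_diagonalizable Asym.
have fAP : fun_calc f A *m P = P *m diag_mx (map_mx f d).
  have eigen_col i : A *m col i P = d 0 i *: col i P.
    rewrite [X in _ *m X]colE mulmxA AP -colE; apply/colP => k.
    by rewrite [LHS]mxE mul_mx_diag !mxE mulrC.
  apply/matrixP => k i; have /colP/(_ k) := fun_calc_eigen f Asym (eigen_col i).
  by rewrite [X in _ *m X]colE mulmxA -colE mul_mx_diag [LHS]mxE !mxE mulrC => ->.
apply: perm_trans (spectrum_diagonalized Pu fAP) _.
have -> : [seq map_mx f d 0 i | i : 'I_n] = map f [seq d 0 i | i : 'I_n].
  by rewrite -map_comp; apply: eq_map => i /=; rewrite mxE.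
by rewrite perm_map // perm_sym (spectrum_diagonalized Pu AP).
Qed.

Lemma size_spectrum (R : realType) n (A : 'M[R]_n) : A^T = A -> size (spectrum A) = n.
Proof.
case/symmetric_diagonalizable => P Pu [d AP].
by rewrite (perm_size (spectrum_diagonalized Pu AP)) size_map size_enum_ord.
Qed.

(** * The Laplacian of the lift *)

Section Lap.
Variables (R : realType) (n : nat) (G : sgraph n).

Lemma degree_sum i : (degree G i)%:R = \sum_j (G i j)%:R :> R.
Proof.
by rewrite /degree -sum1dep_card natr_sum big_mkcond; apply: eq_bigr => j _; case: ifP.
Qed.

Lemma laplacian_sym : (laplacian R G)^T = laplacian R G.
Proof.
rewrite /laplacian linearB /= tr_diag_mx; congr (_ - _).
by apply/matrixP => i j; rewrite !mxE adj_sym.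
Qed.

Lemma laplacian_const : laplacian R G *m const_mx 1 = 0 :> 'cV_n.
Proof.
apply/colP => i; rewrite mulmxBl mul_diag_mx !mxE mulr1 degree_sum.
by apply/eqP; rewrite subr_eq0; apply/eqP/eq_bigr => j _; rewrite !mxE mulr1.
Qed.

(** The factor 2 appears because the sum runs over ordered pairs, so that every
edge is counted twice. *)
Lemma laplacian_form (v : 'rV[R]_n) :
  ((v *m laplacian R G *m v^T) 0 0) *+ 2 =
  \sum_i \sum_j (G i j)%:R * (v 0 i - v 0 j) ^+ 2.
Proof.
have -> : (v *m laplacian R G *m v^T) 0 0 =
    \sum_i \sum_j (G i j)%:R * (v 0 i ^+ 2 - v 0 i * v 0 j).
  rewrite -mulmxA mxE; apply: eq_bigr => i _.
  rewrite mulmxBl mul_diag_mx !mxE degree_sum mulr_suml mulrBr !mulr_sumr -sumrB.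
  by apply: eq_bigr => j _; rewrite !mxE; ring.
rewrite mulr2n [X in _ + X]exchange_big -big_split /=; apply: eq_bigr => i _.
rewrite -big_split /=; apply: eq_bigr => j _.
by rewrite [in X in _ + X]adj_sym; ring.
Qed.

Lemma laplacian_eigen_ge0 x : eigenvalue (laplacian R G) x -> 0 <= x.
Proof.
case/eigenvalueP => v vL v0.
have: 0 <= ((v *m laplacian R G *m v^T) 0 0) *+ 2.
  rewrite laplacian_form; do 2!apply: sumr_ge0 => ? _.
  by rewrite mulr_ge0 ?ler0n ?sqr_ge0.
rewrite pmulrn_lge0 // vL -scalemxAl mxE pmulr_lge0 // mxE.
have ge0 i : 0 <= v 0 i * v^T i 0 by rewrite mxE -expr2 sqr_ge0.
rewrite lt_neqAle sumr_ge0 ?andbT // eq_sym; apply: contra v0 => /eqP/psumr_eq0P v0.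
by apply/eqP/rowP => i; have /eqP := v0 (fun i _ => ge0 i) i isT;
  rewrite !mxE mulf_eq0 orbb => /eqP.
Qed.

End Lap.

Section LoopLap.
Variables (R : realType) (n : nat) (G : sgraph n) (S : {set 'I_n}).
Local Notation s := (loop_vector R S).
Local Notation LS := (loop_laplacian R G S).
Local Notation LL := (laplacian R (acikmese_lift G S)).

Lemma loop_laplacian_sym : LS^T = LS.
Proof. by rewrite linearD /= tr_diag_mx laplacian_sym. Qed.

Lemma Msym_sym : (Msym R G S)^T = Msym R G S.
Proof.
by rewrite tr_block_mx tr_scalar_mx !linearZ /= trmxK loop_laplacian_sym.
Qed.

Lemma loop_vector_sum : \sum_i (i \in S)%:R = #|S|%:R :> R.
Proof. by rewrite -sum1_card natr_sum [RHS]big_mkcond; apply: eq_bigr => j _; case: ifP. Qed.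

Lemma Msym_null : Msym R G S *m col_mx 1%:M (const_mx (Num.sqrt 2)) = 0.
Proof.
have sq2 : Num.sqrt 2 * Num.sqrt 2 = 2 :> R by rewrite -expr2 sqr_sqrtr.
rewrite mul_block_col; apply/eqP; rewrite col_mx_eq0; apply/andP; split; apply/eqP.
  apply/matrixP => i j; rewrite !ord1 mulmx1 -scalemxAl !mxE mulr1n.
  rewrite (eq_bigr (fun k => (k \in S)%:R * Num.sqrt 2)); last by move=> k _; rewrite !mxE.
  by rewrite -mulr_suml loop_vector_sum mulrCA mulNr sq2; ring.
have -> : const_mx (Num.sqrt 2) = Num.sqrt 2 *: const_mx 1 :> 'cV[R]_n.
  by apply/matrixP => i j; rewrite !mxE mulr1.
rewrite mulmx1 -scalemxAr mulmxDl laplacian_const add0r mul_diag_mx.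
by apply/matrixP => i j; rewrite !mxE mulr1; ring.
Qed.

Lemma lift_lo_lo i j : lift_adj G S (lo i) (lo j) = G i j.
Proof.
apply/orP/idP => [[/existsP[a /existsP[b]]|/existsP[a]]|Gij].
- case/andP => Gab /orP[] /orP[] /andP[].
  + by move=> /eqP/lshift_inj-> /eqP/lshift_inj->.
  + by move=> /eqP/lshift_inj-> /eqP/lshift_inj->; rewrite adj_sym.
  + by rewrite eq_lrshift.
  + by rewrite eq_lrshift.
- by rewrite /same_edge !eq_lrshift /= ?andbF.
- by left; apply/existsP; exists i; apply/existsP; exists j; rewrite Gij /same_edge !eqxx.
Qed.

Lemma lift_hi_hi i j : lift_adj G S (hi i) (hi j) = G i j.
Proof.
apply/orP/idP => [[/existsP[a /existsP[b]]|/existsP[a]]|Gij].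
- case/andP => Gab /orP[] /orP[] /andP[].
  + by rewrite eq_rlshift.
  + by rewrite eq_rlshift.
  + by move=> /eqP/rshift_inj/rshift_inj-> /eqP/rshift_inj/rshift_inj->.
  + by move=> /eqP/rshift_inj/rshift_inj-> /eqP/rshift_inj/rshift_inj->; rewrite adj_sym.
- by rewrite /same_edge !eq_rlshift !eq_rshift !eq_rlshift /= ?andbF.
- left; apply/existsP; exists i; apply/existsP; exists j.
  by rewrite Gij /same_edge !eqxx orbT.
Qed.

Lemma lift_lo_hi i j : lift_adj G S (lo i) (hi j) = false.
Proof.
apply/negbTE/negP => /orP[/existsP[a /existsP[b]]|/existsP[a]] /andP[_].
  by rewrite /same_edge !eq_lrshift !eq_rlshift /= ?andbF.
by rewrite /same_edge !eq_lrshift !eq_rlshift !eq_rshift !eq_rlshift /= ?andbF.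
Qed.

Lemma lift_lo_mid i : lift_adj G S (lo i) (mid n) = (i \in S).
Proof.
apply/orP/idP => [[/existsP[a /existsP[b]]|/existsP[a]]|Si].
- by rewrite /same_edge !eq_lrshift !eq_rlshift /= ?andbF.
- case/andP => Sa /orP[] /orP[] /andP[].
  + by move=> /eqP/lshift_inj->.
  + by rewrite eq_lrshift.
  + by rewrite eq_lrshift.
  + by rewrite eq_lrshift.
- by right; apply/existsP; exists i; rewrite Si /same_edge !eqxx.
Qed.

Lemma lift_hi_mid i : lift_adj G S (hi i) (mid n) = (i \in S).
Proof.
apply/orP/idP => [[/existsP[a /existsP[b]]|/existsP[a]]|Si].
- by rewrite /same_edge !eq_rlshift !eq_rshift !eq_lrshift /= ?andbF.
- case/andP => Sa /orP[] /orP[] /andP[].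
  + by rewrite eq_rlshift.
  + by rewrite eq_rshift eq_rlshift.
  + by rewrite eq_rshift eq_rlshift.
  + by move=> /eqP/rshift_inj/rshift_inj->.
- by right; apply/existsP; exists i; rewrite Si /same_edge !eqxx !orbT.
Qed.

Lemma lift_mid_mid : lift_adj G S (mid n) (mid n) = false.
Proof. exact: lift_adj_irrefl. Qed.

Lemma lift_laplacianE : LL =
  block_mx LS (row_mx (- s) 0)
   (col_mx (- s^T) 0) (block_mx (#|S|%:R *+ 2)%:M (- s^T) (- s) LS).
Proof.
have sumE (F : 'I_(n + (1 + n)) -> R) :
    \sum_v F v = \sum_i F (lo i) + (F (mid n) + \sum_i F (hi i)).
  by rewrite !big_split_ord /= big_ord1.
have diagE (u v : 'I_(n + (1 + n))) : LL u v =
    (\sum_w (lift_adj G S u w)%:R) *+ (u == v) - (lift_adj G S u v)%:R.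
  by rewrite !mxE degree_sum.
have LSE i j : LS i j =
    (\sum_k (G i k)%:R + (i \in S)%:R) *+ (i == j) - (G i j)%:R.
  by rewrite !mxE degree_sum mulrnDl addrAC.
have mid_lo i := lift_adj_sym G S (mid n) (lo i).
have mid_hi i := lift_adj_sym G S (mid n) (hi i).
have hi_lo i j := lift_adj_sym G S (hi i) (lo j).
have row_lo i : \sum_w (lift_adj G S (lo i) w)%:R
    = \sum_k (G i k)%:R + (i \in S)%:R :> R.
  rewrite sumE lift_lo_mid [X in _ + (_ + X)]big1 ?addr0; last first.
    by move=> k _; rewrite lift_lo_hi.
  by congr (_ + _); apply: eq_bigr => k _; rewrite lift_lo_lo.
have row_hi i : \sum_w (lift_adj G S (hi i) w)%:R
    = \sum_k (G i k)%:R + (i \in S)%:R :> R.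
  rewrite sumE lift_hi_mid big1 ?add0r; last first.
    by move=> k _; rewrite hi_lo lift_lo_hi.
  by rewrite addrC; congr (_ + _); apply: eq_bigr => k _; rewrite lift_hi_hi.
have row_mid : \sum_w (lift_adj G S (mid n) w)%:R = #|S|%:R *+ 2 :> R.
  rewrite sumE lift_mid_mid add0r mulr2n -loop_vector_sum.
  by congr (_ + _); apply: eq_bigr => k _; rewrite (mid_lo, mid_hi) (lift_lo_mid, lift_hi_mid).
have lo_inj (i j : 'I_n) : (lo i == lo j) = (i == j) by exact: eq_lshift.
have hi_inj (i j : 'I_n) : (hi i == hi j) = (i == j) by rewrite 2!eq_rshift.
rewrite -[LHS]submxK -[drsubmx LL]submxK -[ursubmx LL]hsubmxK -[dlsubmx LL]vsubmxK.
have vS (i : 'I_1) : rshift n (lshift n i) = mid n by rewrite ord1.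
congr block_mx; first 2 [congr row_mx | congr col_mx];
  try congr block_mx; apply/matrixP => i j; rewrite ?LSE.
- rewrite 2![LHS]mxE diagE.
  by rewrite row_lo lo_inj lift_lo_lo.
- by rewrite 3![LHS]mxE vS diagE lift_lo_mid !mxE eq_lrshift sub0r.
- rewrite 3![LHS]mxE diagE lift_lo_hi !mxE eq_lrshift.
  by rewrite subr0.
- rewrite 3![LHS]mxE vS diagE mid_lo lift_lo_mid !mxE eq_rlshift.
  by rewrite sub0r.
- rewrite 3![LHS]mxE diagE hi_lo lift_lo_hi !mxE eq_rlshift.
  by rewrite subr0.
- rewrite 4![LHS]mxE !vS diagE row_mid lift_mid_mid eqxx.
  by rewrite !mxE !ord1 subr0.
- rewrite 4![LHS]mxE vS diagE mid_hi lift_hi_mid !mxE eq_rshift eq_lrshift.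
  by rewrite sub0r.
- rewrite 4![LHS]mxE vS diagE lift_hi_mid !mxE eq_rshift eq_rlshift.
  by rewrite sub0r.
- rewrite 4![LHS]mxE diagE.
  by rewrite row_hi hi_inj lift_hi_hi.
Qed.

(** The columns of P form the orthonormal basis adapted to the swap: first the
odd vectors (lo i - hi i) / sqrt 2, then the middle vertex followed by the even
vectors (lo i + hi i) / sqrt 2. *)
Lemma lift_similar : exists2 P, P \in unitmx &
  LL *m P = P *m block_mx LS 0 0 (Msym R G S).
Proof.
pose a : R := (Num.sqrt 2)^-1.
have sq2 : Num.sqrt 2 * Num.sqrt 2 = 2 :> R by rewrite -expr2 sqr_sqrtr.
have sq0 : Num.sqrt 2 != 0 :> R by rewrite sqrtr_eq0 -ltNge ltr0n.
have aa : a * a + a * a = 1 by rewrite -invfM sq2; field.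
pose P := block_mx (a%:M : 'M[R]_n) (row_mx 0 a%:M)
  (col_mx 0 (- a%:M)) (block_mx (1%:M : 'M[R]_1) 0 0 a%:M).
exists P.
  suff /mulmx1_unit[] : P *m P^T = 1%:M by [].
  rewrite /P !(tr_block_mx, tr_row_mx, tr_col_mx) !linearN /= !tr_scalar_mx !trmx0.
  rewrite mulmx_block.
  rewrite !(mul_row_col, mul_col_row, mul_row_block, mul_block_col, mulmx_block, mul_mx_row, mul_col_mx).
  rewrite !(mul0mx, mulmx0, mulmx1, mul1mx, add0r, addr0, mulNmx, mulmxN, opprK) -!scalar_mxM.
  rewrite !(add_row_mx, add_col_mx, add_block_mx, add0r, addr0, addrN, addNr).
  rewrite ?oppr0 ?(row_mx0, col_mx0) -?raddfD /= aa.
  by rewrite -block_mxEv -!scalar_mx_block.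
rewrite lift_laplacianE /P /Msym.
rewrite !(mul_row_col, mul_col_row, mul_row_block, mul_block_col, mulmx_block, mul_mx_row, mul_col_mx).
rewrite !(mul0mx, mulmx0, mulmx1, mul1mx, add0r, addr0, mulNmx, mulmxN, opprK) ?mulmx0.
rewrite !(add_row_mx, add_col_mx, add_block_mx, add0r, addr0, addrN, addNr).
have a2 : a + a = Num.sqrt 2 by apply: (mulIf sq0); rewrite mulrDl mulVf // sq2.
rewrite !mul_mx_scalar !mul_scalar_mx !scalerA mulrN mulVf // scaleN1r.
by rewrite -opprD -scalerDl a2 scaleNr.
Qed.

End LoopLap.

Lemma spectrum_lift (R : realType) n (G : sgraph n) (S : {set 'I_n}) :
  perm_eq (spectrum (laplacian R (acikmese_lift G S)))
    (spectrum (Msym R G S) ++ spectrum (loop_laplacian R G S)).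
Proof.
have [P Pu LP] := lift_similar R G S; apply/allP => x _ /=.
rewrite count_cat !count_spectrum (char_poly_similar Pu LP).
rewrite {1}/char_poly char_block_diag_mx det_ublock -/(char_poly _) -/(char_poly _).
by rewrite mupM ?char_poly_neq0 // addnC.
Qed.

(** * Cutting a sequence into two halves *)

(** Both cuts t ++ u and a ++ b have the same total of (x - m)^+; on t it is the
sum of x - m, since t lies above m, and on u it is 0.  On a it differs from the
sum of x - m by the sum of (m - x)^+. *)
Lemma sum_above_threshold_gap (R : realDomainType) (m : R) (a b t u : seq R) :
  size a = size t -> perm_eq (t ++ u) (a ++ b) ->
  {in t, forall x, m <= x} -> {in u, forall x, x <= m} ->
  \sum_(x <- t) x - \sum_(x <- a) x
  = \sum_(x <- a) Num.max (m - x) 0 + \sum_(x <- b) Num.max (x - m) 0.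
Proof.
move=> sz tu_ab tm um.
have: \sum_(x <- t ++ u) Num.max (x - m) 0 = \sum_(x <- a ++ b) Num.max (x - m) 0.
  exact: perm_big.
rewrite !big_cat /= [X in _ + X = _]big_seq [X in _ + X = _]big1 ?addr0; last first.
  by move=> x /um xm; apply/max_idPr; rewrite subr_le0.
rewrite [LHS]big_seq (eq_bigr (fun x => x - m)); last first.
  by move=> x /tm mx; apply/max_idPl; rewrite subr_ge0.
rewrite -big_seq sumrB => tE.
have aE : \sum_(x <- a) Num.max (x - m) 0 =
    \sum_(x <- a) x - \sum_(x <- a) m + \sum_(x <- a) Num.max (m - x) 0.
  rewrite -sumrB -big_split /=; apply: eq_bigr => x _.
  case: (lerP m x) => mx.
    have := mx; rewrite -subr_ge0 => /max_idPl ->.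
    by have := mx; rewrite -subr_le0 => /max_idPr ->; rewrite addr0.
  have /ltW := mx; rewrite -subr_ge0 => /max_idPl ->.
  have /ltW := mx; rewrite -subr_le0 => /max_idPr ->.
  by rewrite addrA subrK subrr.
have mE : \sum_(x <- a) m = \sum_(x <- t) m by rewrite !big_const_seq !count_predT sz.
move: tE; rewrite aE mE => tE.
rewrite -[\sum_(x <- t) x](subrK (\sum_(x <- t) m)) tE.
by rewrite -!addrA; ring.
Qed.

Section Extremal.
Variable R : realType.
Implicit Types (a b s : seq R).

Lemma le_seq_minP s z : (0 < size s)%N ->
  reflect {in s, forall x, z <= x} (z <= seq_min s).
Proof.
case: s => // h s _; apply: (iffP idP) => [le_z x xs|zs].
  by apply: le_trans le_z _; exact: (ge_bigmin_seq _ x _ id).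
rewrite /seq_min big_seq; elim/big_ind: _ => //.
  by apply: zs; rewrite mem_head.
by move=> x y zx zy; rewrite le_min zx.
Qed.

Lemma seq_max_leP s z : (0 < size s)%N ->
  reflect {in s, forall x, x <= z} (seq_max s <= z).
Proof.
case: s => // h s _; apply: (iffP idP) => [le_z x xs|zs].
  by apply: le_trans _ le_z; exact: (le_bigmax_seq _ x _ id).
rewrite /seq_max big_seq; elim/big_ind: _ => //.
  by apply: zs; rewrite mem_head.
by move=> x y zx zy; rewrite ge_max zx.
Qed.

Lemma sum_above_threshold_le (m : R) a b t u :
  size a = size t -> perm_eq (t ++ u) (a ++ b) ->
  {in t, forall x, m <= x} -> {in u, forall x, x <= m} ->
  \sum_(x <- a) x <= \sum_(x <- t) x ?= iff
    all (fun x => m <= x) a && all (fun x => x <= m) b.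
Proof.
move=> sz tu_ab tm um; have gap := sum_above_threshold_gap sz tu_ab tm um.
have ge0 (s : seq R) (F : R -> R) : 0 <= \sum_(x <- s) Num.max (F x) 0.
  by apply: sumr_ge0 => x _; rewrite le_max lexx orbT.
have eq0 (s : seq R) (F : R -> R) :
    (\sum_(x <- s) Num.max (F x) 0 == 0) = all (fun x => F x <= 0) s.
  rewrite psumr_eq0; last by move=> x _; rewrite le_max lexx orbT.
  by apply: eq_all => x /=; rewrite eq_maxr.
split; first by rewrite -subr_ge0 gap addr_ge0.
rewrite eq_sym -subr_eq0 gap paddr_eq0 // !eq0.
by congr (_ && _); apply: eq_all => x; rewrite subr_le0.
Qed.

(** Sorted decreasingly, s is the sorted a ++ b followed by l, so the two sums on
the right run over its first and its second half. *)
Lemma top_bottom_gap (l : R) a b s N : size a = N -> size b = N -> (0 < N)%N ->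
  perm_eq s (l :: a ++ b) -> {in a ++ b, forall x, l <= x} ->
  let e k := nth 0 (sort >=%R s) k.-1 in
  let lhs := l + \sum_(x <- a) x - \sum_(x <- b) x in
  let rhs := l + \sum_(1 <= i < N.+1) e i - \sum_(N.+1 <= i < (2 * N).+1) e i in
  e (2 * N + 1)%N = l /\
  (lhs <= rhs /\ (lhs = rhs <-> seq_max b <= seq_min a)).
Proof.
move=> sa sb N0 s_ab l_min e lhs rhs.
pose t := sort >=%R (a ++ b).
have st : size t = (N + N)%N by rewrite size_sort size_cat sa sb.
have t_ab : perm_eq t (a ++ b) by rewrite perm_sort.
have ge_anti : antisymmetric (>=%R : rel R).
  by move=> x y; rewrite andbC => /le_anti.
have ge_tr : transitive (>=%R : rel R) by move=> x y z yx zx; exact: le_trans zx yx.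
have ge_total : total (>=%R : rel R) by move=> x y; exact: le_total.
have ge_refl : reflexive (>=%R : rel R) by move=> x; exact: lexx.
have t_sorted : sorted >=%R t by exact: sort_sorted.
have es : sort >=%R s = rcons t l.
  apply: (sorted_eq ge_tr ge_anti).
  - exact: sort_sorted.
  - rewrite sorted_pairwise // pairwise_rcons -sorted_pairwise // t_sorted andbT.
    by apply/allP => x; rewrite (perm_mem t_ab) => /l_min.
  - by rewrite perm_sort (perm_trans s_ab) // perm_sym perm_rcons perm_cons.
have e_t k : (k < N + N)%N -> e k.+1 = nth 0 t k.
  by move=> kN; rewrite /e es nth_rcons st kN.
have top : \sum_(1 <= i < N.+1) e i = \sum_(x <- take N t) x.
  rewrite big_add1 /= [RHS](big_nth 0) size_takel ?st ?leq_addr //.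
  apply: eq_big_nat => k /andP[_ kN].
  by rewrite e_t ?nth_take // (leq_trans kN) ?leq_addr.
have bot : \sum_(N.+1 <= i < (2 * N).+1) e i = \sum_(x <- drop N t) x.
  rewrite big_add1 /= [RHS](big_nth 0) size_drop st addnK mul2n -addnn.
  rewrite -{1}[N]add0n big_addn addnK.
  apply: eq_big_nat => k /andP[_ kN].
  by rewrite e_t ?ltn_add2r // nth_drop addnC.
split.
  by rewrite /e es addn1 /= nth_rcons st mul2n addnn ltnn eqxx.
have total : \sum_(x <- take N t) x + \sum_(x <- drop N t) x =
    \sum_(x <- a) x + \sum_(x <- b) x.
  by rewrite -!big_cat /= cat_take_drop (perm_big _ t_ab).
have sz : size a = size (take N t) by rewrite size_takel ?st ?leq_addr.
have [m [mt mu]] : exists m, {in take N t, forall x, m <= x} /\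
    {in drop N t, forall x, x <= m}.
  (* The N-th largest element separates the two halves. *)
  exists (nth 0 t N.-1); split=> x.
    case/(nthP 0) => i; rewrite -sz sa => iN <-; rewrite nth_take //.
    apply: (sorted_leq_nth ge_tr ge_refl 0 t_sorted) => //; rewrite ?inE ?st.
    - by rewrite (leq_trans iN) ?leq_addr.
    - by rewrite prednK // leq_addr.
    - by rewrite -ltnS prednK.
  case/(nthP 0) => i; rewrite size_drop st addnK => iN <-; rewrite nth_drop.
  apply: (sorted_leq_nth ge_tr ge_refl 0 t_sorted) => //; rewrite ?inE ?st.
  - by rewrite prednK // leq_addr.
  - by rewrite ltn_add2l.
  - by rewrite (leq_trans (leq_pred _)) ?leq_addr.
have cut : perm_eq (take N t ++ drop N t) (a ++ b) by rewrite cat_take_drop.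
have [gap gapE] := sum_above_threshold_le sz cut mt mu.
have -> : (lhs <= rhs) = (\sum_(x <- a) x <= \sum_(x <- take N t) x).
  by rewrite /lhs /rhs top bot; apply/idP/idP; move: total; lra.
have -> : (lhs = rhs) <-> (\sum_(x <- a) x = \sum_(x <- take N t) x).
  by rewrite /lhs /rhs top bot; split; move: total; lra.
split=> //; rewrite -sa in N0.
split=> [/eqP|ba].
  rewrite gapE => /andP[/allP am /allP bm].
  apply/seq_max_leP => [|y yb]; first by rewrite sb -sa.
  by apply/le_seq_minP => // x xa; rewrite (le_trans (bm y yb)) ?am.
(* The minimum of a is a threshold for the cut a ++ b, so here a plays the
   part of the upper half. *)
have a_ge : {in a, forall x, seq_min a <= x} by exact/le_seq_minP.
have b_le : {in b, forall x, x <= seq_min a}.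
  by apply/seq_max_leP; rewrite // sb -sa.
rewrite perm_sym in cut.
have [le_ta _] := sum_above_threshold_le (esym sz) cut a_ge b_le.
by apply/le_anti; rewrite gap le_ta.
Qed.
End Extremal.

(** * Moments and the extremal eigenvalue *)

Lemma moment_spectrum (R : realType) n (B : 'M[R]_n) (q c : R) : B^T = B ->
  moment q B c = \sum_(x <- spectrum (Phi q B c)) x.
Proof.
by move=> Bsym; rewrite (perm_big _ (spectrum_fun_calc _ Bsym)) big_map.
Qed.

(** The kernel vector (1, sqrt 2, .., sqrt 2) is the constant vector of the lift
written in the basis of [lift_similar]. *)
Lemma eigenvalue_Msym0 (R : realType) n (G : sgraph n) (S : {set 'I_n}) :
  eigenvalue (Msym R G S) 0.
Proof.
apply/eigenvalueP; exists (col_mx 1%:M (const_mx (Num.sqrt 2)))^T.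
  by rewrite scale0r -{1}Msym_sym -trmx_mul Msym_null trmx0.
rewrite trmx_eq0 col_mx_eq0 negb_and; apply/orP; left.
by apply/eqP => /matrixP/(_ 0 0)/eqP; rewrite !mxE oner_eq0.
Qed.

Lemma involution_mx_const (R : realType) n :
  (involution_mx R n - 1%:M) *m const_mx 1 = 0 :> 'cV_(n + (1 + n)).
Proof.
rewrite mulmxBl mul1mx; apply/eqP; rewrite subr_eq0; apply/eqP/colP => u.
rewrite !mxE (bigD1 (swap u)) //= !mxE eqxx mulr1 big1 ?addr0 // => v.
by rewrite !mxE => /negbTE->; rewrite mul0r.
Qed.

Theorem theorem4p9 (R : realType) (N : nat) (G : sgraph N) (S : {set 'I_N})
    (q c : R) (hS : (1 <= #|S|)%N) (hq : 0 < q) (hc : c <= 0) :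
  let PhiLift := Phi q (laplacian R (acikmese_lift G S)) c in
  let PhiM := Phi q (Msym R G S) c in
  let PhiL := Phi q (loop_laplacian R G S) c in
  let e := eig PhiLift in
  let elast := e (2 * N + 1)%N in
  let one := const_mx 1 : 'cV[R]_(N + (1 + N)) in
  let lhs := moment q (Msym R G S) c - moment q (loop_laplacian R G S) c in
  let rhs := elast + \sum_(1 <= i < N.+1) e i
             - \sum_(N.+1 <= i < (2 * N).+1) e i in
  [/\ 0 <= elast,
      PhiLift *m one = elast *: one,
      (involution_mx R N - 1%:M) *m one = 0,
      elast \in spectrum PhiM &
      lhs <= rhs /\
      (lhs = rhs <->
       seq_max (spectrum PhiL) <= seq_min (rem elast (spectrum PhiM)))].
Proof.
move=> PhiLift PhiM PhiL e elast one lhs rhs.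
pose f (x : R) := `|x - c| `^ q; pose l := f 0.
have N0 : (0 < N)%N by rewrite -[N]card_ord (leq_trans hS) ?max_card.
have Lsym := laplacian_sym R (acikmese_lift G S).
have [Msym_s LSsym] := (Msym_sym R G S, loop_laplacian_sym R G S).
have specLift : perm_eq (spectrum PhiLift)
    (spectrum PhiM ++ spectrum PhiL).
  apply: perm_trans (spectrum_fun_calc f Lsym) _.
  apply: perm_trans (perm_map f (spectrum_lift R G S)) _.
  by rewrite map_cat perm_sym perm_cat // spectrum_fun_calc.
have l_min x : x \in spectrum PhiLift -> l <= x.
  rewrite (perm_mem (spectrum_fun_calc f Lsym)) => /mapP[y yL ->].
  have y0 : 0 <= y by apply: laplacian_eigen_ge0; rewrite -mem_spectrum; exact: yL.
  rewrite /l /f sub0r; apply: ge0_ler_powR; rewrite ?nnegrE ?normr_ge0 ?(ltW hq) //.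
  by rewrite !ger0_norm; lra.
have lM : l \in spectrum PhiM.
  rewrite (perm_mem (spectrum_fun_calc f Msym_s)); apply/map_f.
  by rewrite mem_spectrum eigenvalue_Msym0.
have size_Phi n (B : 'M[R]_n) : B^T = B -> size (spectrum (Phi q B c)) = n.
  move=> Bsym; rewrite (perm_size (spectrum_fun_calc _ Bsym)) size_map.
  exact: size_spectrum.
have specM := perm_to_rem lM.
have cut : perm_eq (spectrum PhiLift)
    (l :: rem l (spectrum PhiM) ++ spectrum PhiL).
  by apply: perm_trans specLift _; rewrite -cat_cons perm_cat2r.
have sa : size (rem l (spectrum PhiM)) = N by rewrite size_rem // size_Phi.
have ab_min : {in rem l (spectrum PhiM) ++ spectrum PhiL, forall x, l <= x}.
  by move=> x xab; apply: l_min; rewrite (perm_mem cut) inE xab orbT.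
have [elastE gap] := top_bottom_gap sa (size_Phi _ _ LSsym) N0 cut ab_min.
have {}elastE : elast = l by exact: elastE.
have lhsE : lhs = l + \sum_(x <- rem l (spectrum PhiM)) x
    - \sum_(x <- spectrum PhiL) x.
  by rewrite /lhs !moment_spectrum // (perm_big _ specM) big_cons.
rewrite /rhs elastE lhsE; split=> //.
- exact: powR_ge0.
- by apply: fun_calc_eigen; rewrite // laplacian_const scale0r.
- exact: involution_mx_const.
Qed.
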